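(* Let $[a,b]$ be an interval, let $u$ be a positive weight function on $[a,b]$, let $T(n,x)$ be an $n$-dimensional linear space of functions on $[a,b]$, and let $Q_1,\dots,Q_n$ be an orthonormal basis of $T(n,x)$ with respect to the inner product $f\cdot g=\int_a^b u(x)f(x)\overline{g(x)}\,dx$. Let $x_1,\dots,x_n$ be distinct points of $[a,b]$, and let $Q(n,\{x_j\})$ be the $n\times n$ matrix whose $(i,j)$ entry is $Q_i(x_j)$. Then there exist nonzero weights $w_1,\dots,w_n$ such that the $n$-term quadrature $\{x_j,w_j\}$ integrates all inner products in $T(n,x)$, i.e. $$\int_a^b u(x)f(x)\overline{g(x)}\,dx=\sum_{j=1}^n w_j f(x_j)\overline{g(x_j)}\quad\text{for all } f,g\in T(n,x),$$ if and only if the $n$ columns of $Q(n,\{x_j\})$ are orthogonal (nonzero and pairwise orthogonal in $\mathbb{C}^n$).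
   Context: The functions in $T(n,x)$ are complex-valued functions on $[a,b]$ with well-defined point values, belonging to $L^2$ with the inner product $f\cdot g=\int_a^b u f\bar g\,dx$. An $n$-term quadrature $\{x_j,w_j\}$ is one with distinct nodes $x_j\in[a,b]$ and nonzero weights $w_j$, $j=1,\dots,n$. *)

(* Defs.v *)
From HB Require Import structures.
From mathcomp Require Import all_boot all_order all_algebra.
From mathcomp Require Import sesquilinear spectral.
From mathcomp Require Import complex.
From mathcomp Require Import all_classical all_reals all_analysis.
Import Order.TTheory GRing.Theory Num.Theory.
Import numFieldNormedType.Exports.

Set Implicit Arguments.
Unset Strict Implicit.
Unset Printing Implicit Defensive.

Local Open Scope classical_set_scope.
Local Open Scope ring_scope.
Local Open Scope complex_scope.

(* The real line with the sigma-algebra of Lebesgue measurable sets, on which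
   completed_lebesgue_measure lives; the library's canonical measurable
   structure on R is the Borel one. *)
Notation lebesgueType R :=
  (caratheodory_type ((wlength (@idfun (Real.sort R)))^*)%mu).

Section WeightedL2.
Context {R : realType} {a b : R}.
Implicit Types (u : `[a, b]%classic -> R) (f g : `[a, b]%classic -> R[i])
  (T : set (`[a, b]%classic -> R[i])) (n : nat).

(* Functions on [a, b] have the subtype as domain, so that equality is equality
   of point values on [a, b]; valL_ 0 extends by 0 in order to integrate. *)
Definition lebesgue_measurable_fun (h : `[a, b]%classic -> R) : Prop :=
  measurable_fun (`[a, b]%classic : set (lebesgueType R))
    (valL_ 0 h : lebesgueType R -> R).

Definition cintegral f : R[i] :=
  (\int[@completed_lebesgue_measure R]_(x in `[a, b])
     complex.Re (valL_ 0 f x)) +i*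
  (\int[@completed_lebesgue_measure R]_(x in `[a, b])
     complex.Im (valL_ 0 f x)).

Definition wdot u f g : R[i] := cintegral (fun x => (u x)%:C * f x * (g x)^*).

Definition positive_weight u : Prop :=
  lebesgue_measurable_fun u /\ forall x, 0 < u x.

Definition square_integrable u f : Prop :=
  [/\ lebesgue_measurable_fun (fun x => complex.Re (f x)),
      lebesgue_measurable_fun (fun x => complex.Im (f x)) &
      (\int[@completed_lebesgue_measure R]_(x in `[a, b])
         (valL_ 0 (fun y => u y * Normc.normc (f y) ^+ 2)%R x)%:E < +oo)%E].

Definition is_basis T n (e : 'I_n -> `[a, b]%classic -> R[i]) : Prop :=
  (forall c : 'I_n -> R[i], \sum_i c i *: e i = 0 -> forall i, c i = 0) /\
  T = range (fun c : 'I_n -> R[i] => \sum_i c i *: e i).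

Definition linear_space_of_dim T n : Prop :=
  GRing.submod_closed [in T] /\ exists e : 'I_n -> _, is_basis T e.

Definition orthonormal_basis u T n (Q : 'I_n -> `[a, b]%classic -> R[i]) :
    Prop :=
  is_basis T Q /\ forall i j, wdot u (Q i) (Q j) = (i == j)%:R.

Definition integrates_inner_products u T n
    (x : 'I_n -> `[a, b]%classic) (w : 'I_n -> R[i]) : Prop :=
  forall f g, T f -> T g ->
    wdot u f g = \sum_(j < n) w j * f (x j) * (g (x j))^*.

Definition evaluation_mx n (Q : 'I_n -> `[a, b]%classic -> R[i])
    (x : 'I_n -> `[a, b]%classic) : 'M[R[i]]_n :=
  \matrix_(i < n, j < n) Q i (x j).

End WeightedL2.

(* The columns are transposed because dotmx, the Hermitian inner product of
   C^n, is defined on row vectors. *)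
Definition orthogonal_columns (C : numClosedFieldType) (m n : nat)
    (A : 'M[C]_(m, n)) : Prop :=
  (forall j, col j A != 0) /\
  (forall j k, j != k -> dotmx (col j A)^T (col k A)^T = 0).

(* Main.v *)
Require Import Defs.
From mathcomp Require Import all_boot all_order all_algebra.
From mathcomp Require Import sesquilinear spectral ring lra.
From mathcomp Require Import complex.
From mathcomp Require Import all_classical all_reals all_analysis.
From mathcomp Require Import measurable_realfun.
Import Order.TTheory GRing.Theory Num.Theory.
Import numFieldNormedType.Exports.

Local Open Scope classical_set_scope.
Local Open Scope ring_scope.

(** Both sides of a quadrature identity are sesquilinear in (f, g), so a
    quadrature that is exact on the pairs (Q_i, Q_k) of basis functions is exact
    on the whole space ([integrates_basis]).  The Gram matrix of an orthonormal
    basis is the identity, so with A the matrix of the values Q_i (x_j), D the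
    diagonal matrix of the weights and A^* the conjugate transpose of A,
    exactness reads A D A^* = 1.  These matrices are square, so a one-sided
    inverse is two-sided; when the weights are nonzero, the equation therefore
    says A^* A = D^-1.  The entries of A^* A are the inner products of the
    columns of A: to be diagonal with nonzero diagonal entries means that the
    columns are nonzero and pairwise orthogonal, and then the weights are
    w_j = 1 / ||column j||^2 ([orthogonal_columns_weights]).

    The analytic content is the sesquilinearity of the weighted inner product.
    The integral of a function that is not integrable carries no information, so
    additivity needs the products u f g^* to be integrable; this follows from
    2 |f g| <= |f|^2 + |g|^2 for square integrable f and g
    ([integrable_weighted_product]). *)

(** * Matrices with orthogonal columns *)

Section OrthogonalColumns.
Variable C : numClosedFieldType.

Lemma dotmx_col (m n : nat) (A : 'M[C]_(m, n)) (j k : 'I_n) :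
  dotmx (col j A)^T (col k A)^T = ((A^t*)%sesqui *m A) k j.
Proof.
rewrite dotmxE !mxE; apply: eq_bigr => i _.
by rewrite !mxE mulrC.
Qed.

(** The diagonal entries of A^* A are the squared norms of the columns, and the
    inner product is definite: a column vanishes exactly when its diagonal entry
    does. *)
Lemma orthogonal_columns_Gram (m n : nat) (A : 'M[C]_(m, n)) :
  orthogonal_columns A <->
  exists2 d : 'rV[C]_n, (forall j, d 0 j != 0) &
    (A^t*)%sesqui *m A = diag_mx d.
Proof.
set G := ((A^t*)%sesqui *m A).
have dotE j k : dotmx (col j A)^T (col k A)^T = G k j by exact: dotmx_col.
clearbody G.
have normE j : (col j A != 0) = (G j j != 0).
  by rewrite -dotE dnorm_eq0 trmx_eq0.
split=> [[A0 Aort]|[d d0 Gd]].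
  exists (\row_j G j j) => [j|]; first by rewrite mxE -normE.
  apply/matrixP => k j; rewrite !mxE.
  have [->|kj] := eqVneq k j; first by rewrite mulr1n.
  by rewrite mulr0n -dotE Aort// eq_sym.
split=> [j|j k jk]; first by rewrite normE Gd mxE eqxx mulr1n.
by rewrite dotE Gd mxE eq_sym (negbTE jk) mulr0n.
Qed.

End OrthogonalColumns.

(** The sums are the entries of A D A^*, where D is the diagonal matrix of the
    weights.  A D is a left inverse of the square matrix A^*, hence also a right
    inverse, and A^* A D = 1 makes A^* A the diagonal matrix D^-1; each step can
    be reversed. *)
Lemma orthogonal_columns_weights (C : numClosedFieldType) (n : nat)
    (A : 'M[C]_n) :
  orthogonal_columns A <->
  exists2 w : 'I_n -> C, (forall j, w j != 0) &
    forall i k, \sum_j w j * A i j * (A k j)^* = (i == k)%:R.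
Proof.
have weightsE (w : 'rV[C]_n) :
    (forall i k, \sum_j w 0 j * A i j * (A k j)^* = (i == k)%:R) <->
    A *m diag_mx w *m (A^t*)%sesqui = 1%:M.
  have entryE i k : (A *m diag_mx w *m (A^t*)%sesqui) i k =
      \sum_j w 0 j * A i j * (A k j)^*.
    rewrite mxE; apply: eq_bigr => j _.
    by rewrite mul_mx_diag !mxE (mulrC (A i j)).
  split=> [Aw|Aw i k]; last by rewrite -entryE Aw mxE.
  by apply/matrixP => i k; rewrite entryE Aw mxE.
have diag_mul (d e : 'rV[C]_n) :
    diag_mx d *m diag_mx e = diag_mx (\row_j (d 0 j * e 0 j)).
  by apply/matrixP => i k; rewrite mul_diag_mx !mxE mulrnAr.
rewrite orthogonal_columns_Gram; split=> [[d d0 Gd]|[w w0 Aw]].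
  exists (fun j => (d 0 j)^-1) => [j|]; first by rewrite invr_eq0.
  have /weightsE Aw : A *m diag_mx (\row_j (d 0 j)^-1) *m (A^t*)%sesqui = 1%:M.
    rewrite -mulmxA; apply: mulmx1C; rewrite -mulmxA Gd diag_mul.
    by apply/matrixP => i k; rewrite !mxE mulVf.
  by move=> i k; rewrite -Aw; apply: eq_bigr => j _; rewrite mxE.
have /weightsE : forall i k,
    \sum_j (\row_j w j) 0 j * A i j * (A k j)^* = (i == k)%:R.
  by move=> i k; rewrite -Aw; apply: eq_bigr => j _; rewrite mxE.
(* Cycling A D A^* = 1 once gives D A^* A = 1, and once more A^* A D = 1. *)
rewrite -mulmxA => /mulmx1C; rewrite -mulmxA => /mulmx1C Gw.
exists (\row_j (w j)^-1) => [j|]; first by rewrite mxE invr_eq0.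
have wV : diag_mx (\row_j w j) *m diag_mx (\row_j (w j)^-1) = 1%:M.
  by rewrite diag_mul; apply/matrixP => i k; rewrite !mxE mulfV.
by rewrite -[LHS]mulmx1 -wV mulmxA Gw mul1mx.
Qed.

(** * Integrability and linearity of complex integrals *)

(** With f = p + i q and g = r + i s, the integrand w (p r + q s) is the real
    part of w f g^*; its imaginary part has the same shape, with (- s, r) in
    place of (r, s).  The integrand is dominated by w |f|^2 + w |g|^2. *)
Lemma integrable_weighted_dot (d : measure_display) (T : measurableType d)
    (R : realType) (mu : {measure set T -> \bar R}) (D : set T)
    (w p q r s : T -> R) :
  measurable D -> (forall x, 0 <= w x) -> measurable_fun D w ->
  measurable_fun D p -> measurable_fun D q ->
  measurable_fun D r -> measurable_fun D s ->
  (\int[mu]_(x in D) (w x * (p x ^+ 2 + q x ^+ 2))%:E < +oo)%E ->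
  (\int[mu]_(x in D) (w x * (r x ^+ 2 + s x ^+ 2))%:E < +oo)%E ->
  mu.-integrable D (EFin \o (fun x => w x * (p x * r x + q x * s x))).
Proof.
move=> mD w0 mw mp mq mr ms pq_fin rs_fin.
have sq0 (f g : T -> R) x : 0 <= w x * (f x ^+ 2 + g x ^+ 2).
  by rewrite mulr_ge0// addr_ge0// sqr_ge0.
have isq (f g : T -> R) : measurable_fun D f -> measurable_fun D g ->
    (\int[mu]_(x in D) (w x * (f x ^+ 2 + g x ^+ 2))%:E < +oo)%E ->
    mu.-integrable D (EFin \o (fun x => w x * (f x ^+ 2 + g x ^+ 2))).
  move=> mf mg fg_fin; apply/integrableP; split.
    apply/measurable_EFinP; apply: measurable_funM => //.
    by apply: measurable_funD; exact: measurable_funX.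
  by under eq_integral => x _ do rewrite /= ger0_norm//.
apply: (le_integrable mD _ _
  (integrableD mD (isq p q mp mq pq_fin) (isq r s mr ms rs_fin))).
  apply/measurable_EFinP; apply: measurable_funM => //.
  by apply: measurable_funD; exact: measurable_funM.
move=> x _ /=; rewrite lee_fin [leRHS]ger0_norm ?addr_ge0//.
rewrite -mulrDr normrM (ger0_norm (w0 x)) ler_wpM2l// ler_norml.
(* Expanding the squares (p + r)^2 and (q + s)^2 bounds p r + q s below, the
   squares of the differences bound it above. *)
have := (sqr_ge0 (p x + r x), sqr_ge0 (q x + s x)).
have := (sqr_ge0 (p x - r x), sqr_ge0 (q x - s x)).
have := (sqr_ge0 (p x), sqr_ge0 (q x), sqr_ge0 (r x), sqr_ge0 (s x)).
rewrite !expr2 => -[[[? ?] ?] ?] -[? ?] -[? ?].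
by apply/andP; split; lra.
Qed.

Section ComplexIntegral.
Variables (R : realType) (a b : R).
Local Notation I := (`[a, b]%classic).
Local Notation mu := (@completed_lebesgue_measure R).
Implicit Types (h : I -> R) (u : I -> R) (f g : I -> R[i]).

Lemma measurable_itv_lebesgue :
  measurable (`[a, b]%classic : set (lebesgueType R)).
Proof. by apply: sub_caratheodory; exact: measurable_itv. Qed.

Definition real_integrable h : Prop :=
  mu.-integrable (`[a, b]%classic : set (lebesgueType R))
    (EFin \o (valL_ 0 h : lebesgueType R -> R)).

Definition complex_integrable f : Prop :=
  real_integrable (fun x => complex.Re (f x)) /\
  real_integrable (fun x => complex.Im (f x)).

Definition real_integral h : R :=
  \int[mu]_(x in `[a, b]) (valL_ 0 h x).

(** Extension by 0 outside [a, b] commutes with taking real and imaginary parts,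
    because those of 0 are 0. *)
Lemma cintegralE f : cintegral f =
  Complex (real_integral (fun x => complex.Re (f x)))
          (real_integral (fun x => complex.Im (f x))).
Proof.
by rewrite /cintegral; congr Complex; apply: eq_Rintegral => x _ /=;
  case: (_ x).
Qed.

Lemma real_integral_lin (k l : R) h1 h2 :
  real_integrable h1 -> real_integrable h2 ->
  real_integrable (fun x => k * h1 x + l * h2 x) /\
  real_integral (fun x => k * h1 x + l * h2 x) =
  k * real_integral h1 + l * real_integral h2.
Proof.
move=> i1 i2; have mI := measurable_itv_lebesgue.
have valLE x : valL_ 0 (fun x => k * h1 x + l * h2 x) x =
    k * valL_ 0 h1 x + l * valL_ 0 h2 x.
  by rewrite /valL_ /=; case: ('oinv_set_val x) => //=; rewrite !mulr0 addr0.
have iZ (c : R) h : real_integrable h ->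
    mu.-integrable (`[a, b]%classic : set (lebesgueType R))
      (EFin \o (fun x : lebesgueType R => c * valL_ 0 h x)).
  by move=> ih; exact: (integrableZl mI c ih).
split.
  apply: (eq_integrable mI _ _ _
    (integrableD mI (iZ k _ i1) (iZ l _ i2))) => x _.
  exact: (esym (congr1 EFin (valLE x))).
rewrite /real_integral; under eq_Rintegral do rewrite valLE.
rewrite (RintegralD mI (iZ k _ i1) (iZ l _ i2)).
by rewrite (RintegralZl k mI i1) (RintegralZl l mI i2).
Qed.

(** Re (c f) = p Re f - q Im f and Im (c f) = p Im f + q Re f for c = p + i q,
    so complex linearity is two instances of real linearity.  Integrability is
    carried along in the conclusion for the induction in [cintegral_sum]. *)
Lemma complex_integrableDZ (c : R[i]) f g :
  complex_integrable f -> complex_integrable g ->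
  complex_integrable (fun x => c * f x + g x) /\
  cintegral (fun x => c * f x + g x) = c * cintegral f + cintegral g.
Proof.
move=> [fr fi] [gr gi]; case: c => p q.
have [hr hrE] := real_integral_lin p (- q) _ _ fr fi.
have [hi hiE] := real_integral_lin p q _ _ fi fr.
have [hr' hrE'] := real_integral_lin 1 1 _ _ hr gr.
have [hi' hiE'] := real_integral_lin 1 1 _ _ hi gi.
have ReE : (fun x => complex.Re (Complex p q * f x + g x)) =
  (fun x => 1 * (p * complex.Re (f x) + - q * complex.Im (f x))
            + 1 * complex.Re (g x)).
  apply/funext => x; case: (f x) => r s; case: (g x) => r' s' /=; ring.
have ImE : (fun x => complex.Im (Complex p q * f x + g x)) =
  (fun x => 1 * (p * complex.Im (f x) + q * complex.Re (f x))
            + 1 * complex.Im (g x)).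
  apply/funext => x; case: (f x) => r s; case: (g x) => r' s' /=; ring.
split; first by split; rewrite ?ReE ?ImE.
rewrite !cintegralE ReE ImE hrE' hiE' hrE hiE.
by apply/eqP; rewrite eq_complex /=; apply/andP; split; apply/eqP; ring.
Qed.

Lemma real_integral0 :
  real_integrable (fun=> 0) /\ real_integral (fun=> 0) = 0.
Proof.
have valL0 : valL_ 0 (fun _ : I => 0 : R) = cst 0 :> (lebesgueType R -> R).
  by apply/funext => x; rewrite /valL_ /=; case: ('oinv_set_val x).
split; first by rewrite /real_integrable valL0; exact: integrable0.
rewrite /real_integral valL0.
by rewrite Rintegral_cst ?mul0r//; exact: measurable_itv_lebesgue.
Qed.

Lemma cintegral0 :
  complex_integrable (fun=> 0) /\ cintegral (fun _ : I => 0 : R[i]) = 0.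
Proof.
have [i0 E0] := real_integral0.
split; first by split; exact: i0.
by rewrite cintegralE [LHS](f_equal2 (@Complex R) E0 E0).
Qed.

Lemma cintegral_sum (J : Type) (s : seq J) (c : J -> R[i])
    (h : J -> I -> R[i]) : (forall j, complex_integrable (h j)) ->
  complex_integrable (fun x => \sum_(j <- s) c j * h j x) /\
  cintegral (fun x => \sum_(j <- s) c j * h j x) =
  \sum_(j <- s) c j * cintegral (h j).
Proof.
move=> ih; elim: s => [|j s [hs sE]].
  rewrite big_nil; under [X in complex_integrable X]eq_fun do rewrite big_nil.
  by under [X in cintegral X]eq_fun do rewrite big_nil; exact: cintegral0.
rewrite big_cons -sE.
under [X in complex_integrable X]eq_fun do rewrite big_cons.
under [X in cintegral X]eq_fun do rewrite big_cons.
exact: complex_integrableDZ.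
Qed.

(** This is where positivity of the weight and square integrability enter: they
    provide the dominating function of [integrable_weighted_dot]. *)
Lemma integrable_weighted_product u f g : positive_weight u ->
  square_integrable u f -> square_integrable u g ->
  complex_integrable (fun x => real_complex R (u x) * f x * (g x)^*).
Proof.
move=> [mU u0] f2 g2; have [[mfr mfi _] [mgr mgi _]] := (f2, g2).
have mI := measurable_itv_lebesgue.
pose U : lebesgueType R -> R := valL_ 0 u.
pose re (k : I -> R[i]) : lebesgueType R -> R :=
  valL_ 0 (fun y => complex.Re (k y)).
pose im (k : I -> R[i]) : lebesgueType R -> R :=
  valL_ 0 (fun y => complex.Im (k y)).
have U0 x : 0 <= U x.
  by rewrite /U /valL_ /=; case: ('oinv_set_val x) => //= y; exact/ltW.
have sqE k x : valL_ 0 (fun y => u y * Normc.normc (k y) ^+ 2)%R x =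
    U x * (re k x ^+ 2 + im k x ^+ 2).
  rewrite /U /re /im /valL_ /=.
  case: ('oinv_set_val x) => [y|] /=; last by rewrite mul0r.
  by case: (k y) => p q /=; rewrite sqr_sqrtr ?addr_ge0 ?sqr_ge0.
have sq_fin k : square_integrable u k ->
    (\int[mu]_(x in (`[a, b]%classic : set (lebesgueType R)))
       (U x * (re k x ^+ 2 + im k x ^+ 2))%:E < +oo)%E.
  by move=> [_ _ k2]; under eq_integral => x _ do rewrite -sqE; exact: k2.
have ReE : valL_ 0 (fun x => complex.Re (real_complex R (u x) * f x * (g x)^*))
    = (fun x => U x * (re f x * re g x + im f x * im g x)).
  apply/funext => x; rewrite /U /re /im /valL_ /=.
  case: ('oinv_set_val x) => [y|] /=; last by rewrite !mul0r.
  by case: (f y) => p q; case: (g y) => r s /=; ring.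
have ImE : valL_ 0 (fun x => complex.Im (real_complex R (u x) * f x * (g x)^*))
    = (fun x => U x * (re f x * (- im g x) + im f x * re g x)).
  apply/funext => x; rewrite /U /re /im /valL_ /=.
  case: ('oinv_set_val x) => [y|] /=; last by rewrite !mul0r.
  by case: (f y) => p q; case: (g y) => r s /=; ring.
have mNim : measurable_fun (`[a, b]%classic : set (lebesgueType R))
    (fun x => - im g x) by exact: measurable_funN mgi.
have g2' : (\int[mu]_(x in (`[a, b]%classic : set (lebesgueType R)))
    (U x * ((- im g x) ^+ 2 + re g x ^+ 2))%:E < +oo)%E.
  by under eq_integral => x _ do rewrite sqrrN addrC; exact: sq_fin.
split; rewrite /real_integrable.
  rewrite ReE.
  exact: (integrable_weighted_dot _ _ _ mu _ U (re f) (im f) (re g) (im g)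
    mI U0 mU mfr mfi mgr mgi (sq_fin f f2) (sq_fin g g2)).
rewrite ImE.
exact: (integrable_weighted_dot _ _ _ mu _ U (re f) (im f)
  (fun x => - im g x) (re g) mI U0 mU mfr mfi mNim mgr (sq_fin f f2) g2').
Qed.

End ComplexIntegral.

(** * Exactness on a basis *)

(** The double sum is a single sum over pairs of indices, so that linearity of
    the integral applies once to the family of all products of two members. *)
Lemma wdot_sum (R : realType) (a b : R) (n : nat) (u : `[a, b]%classic -> R)
    (Q : 'I_n -> `[a, b]%classic -> R[i]) (c d : 'I_n -> R[i]) :
  positive_weight u -> (forall i, square_integrable u (Q i)) ->
  wdot u (\sum_i c i *: Q i) (\sum_k d k *: Q k) =
  \sum_i \sum_k c i * (d k)^* * wdot u (Q i) (Q k).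
Proof.
move=> u_pos Q2.
rewrite pair_bigA /=.
have [_ <-] := cintegral_sum R a b _ (index_enum ('I_n * 'I_n)%type)
  (fun p => c p.1 * (d p.2)^*)
  (fun p x => real_complex R (u x) * Q p.1 x * (Q p.2 x)^*)
  (fun p => integrable_weighted_product _ _ _ _ _ _ u_pos
    (Q2 p.1) (Q2 p.2)).
congr cintegral; apply/funext => x; rewrite !fct_sumE.
rewrite -(pair_bigA _ (fun i k => c i * (d k)^* *
  (real_complex R (u x) * Q i x * (Q k x)^*))) /=.
rewrite mulr_sumr mulr_suml; apply: eq_bigr => i _.
rewrite rmorph_sum mulr_sumr; apply: eq_bigr => k _.
have -> : (c i *: Q i) x = c i * Q i x by [].
have -> : (d k *: Q k) x = d k * Q k x by [].
rewrite rmorphM /=; ring.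
Qed.

Lemma basis_in (R : realType) (a b : R) (n : nat)
    (T : set (`[a, b]%classic -> R[i])) (Q : 'I_n -> `[a, b]%classic -> R[i])
    (i : 'I_n) :
  is_basis T Q -> T (Q i).
Proof.
move=> [_ ->]; exists (fun j => (j == i)%:R) => //=.
rewrite (bigD1 i)//= eqxx scale1r big1 ?addr0// => j /negbTE ->.
by rewrite scale0r.
Qed.

(** The quadrature sum is sesquilinear as well, so two sesquilinear forms are
    compared on a basis. *)
Lemma integrates_basis (R : realType) (a b : R) (n : nat)
    (u : `[a, b]%classic -> R) (T : set (`[a, b]%classic -> R[i]))
    (Q : 'I_n -> `[a, b]%classic -> R[i])
    (x : 'I_n -> `[a, b]%classic) (w : 'I_n -> R[i]) :
  positive_weight u -> is_basis T Q ->
  (forall f, T f -> square_integrable u f) ->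
  integrates_inner_products u T x w <->
  forall i k, wdot u (Q i) (Q k) = \sum_j w j * Q i (x j) * (Q k (x j))^*.
Proof.
move=> u_pos QT T2.
have QinT i : T (Q i) by exact: (basis_in _ _ _ _ _ _ i QT).
have Q2 i : square_integrable u (Q i) by exact: T2.
split=> [H i k|H f g]; first exact: H.
case: QT => _ -> [c _ <-] [d _ <-]; rewrite wdot_sum//.
have evalE (e : 'I_n -> R[i]) y : (\sum_i e i *: Q i) y = \sum_i e i * Q i y.
  by rewrite fct_sumE.
under eq_bigr => i _ do under eq_bigr => k _ do rewrite H mulr_sumr.
under eq_bigr => i _ do rewrite exchange_big.
rewrite exchange_big; apply: eq_bigr => j _ /=.
rewrite !evalE mulr_sumr mulr_suml; apply: eq_bigr => i _.
rewrite rmorph_sum mulr_sumr; apply: eq_bigr => k _.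
rewrite rmorphM /=; ring.
Qed.

Theorem theorem1p2 (R : realType) (a b : R) (hab : a < b)
    (u : `[a, b]%classic -> R) (hu : positive_weight u)
    (n : nat) (T : set (`[a, b]%classic -> R[i]))
    (hT : linear_space_of_dim T n)
    (hT2 : forall f, T f -> square_integrable u f)
    (Q : 'I_n -> `[a, b]%classic -> R[i]) (hQ : orthonormal_basis u T Q)
    (x : 'I_n -> `[a, b]%classic) (hx : injective x) :
  (exists w : 'I_n -> R[i],
     (forall j, w j != 0) /\ integrates_inner_products u T x w) <->
  orthogonal_columns (evaluation_mx Q x).
Proof.
case: hQ => QT Qort; rewrite orthogonal_columns_weights.
have weightsE (w : 'I_n -> R[i]) : integrates_inner_products u T x w <->
    forall i k, \sum_j w j * evaluation_mx Q x i j * (evaluation_mx Q x k j)^*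
      = (i == k)%:R.
  rewrite (integrates_basis _ _ _ _ _ _ _ _ _ hu QT hT2).
  by split=> H i k; [rewrite -Qort H|rewrite Qort -H]; apply: eq_bigr => j _;
    rewrite !mxE.
by split=> -[w]; [move=> [w0 /weightsE]|move=> w0 /weightsE]; exists w.
Qed.
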